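(* For any fixed decision $\boldsymbol{x}\in\mathcal{X}$, we have $$\sup_{\mathbb{P}\in\mathcal{F}(\theta)}\mathbb{P}\text{-CVaR}_\varepsilon\big(\boldsymbol{a}^\top\boldsymbol{x}-b_0+(\boldsymbol{A}^\top\boldsymbol{x}-\boldsymbol{b})^\top\tilde{\boldsymbol{\xi}}\big)\le 0 \quad\Longleftrightarrow\quad \frac1N\sum_{i=1}^{\varepsilon N}\mathbf{sgn\text{-}dist}\big(\hat{\boldsymbol{\xi}}_{\pi_i(\boldsymbol{x})},\bar{\mathcal{S}}(\boldsymbol{x})\big)\ge\theta,$$ where $\boldsymbol{\pi}(\boldsymbol{x})$ is a permutation of $[N]$ that arranges the data points $\hat{\boldsymbol{\xi}}_i$ in ascending order of their signed distances to $\bar{\mathcal{S}}(\boldsymbol{x})$.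
   Context: Data: a compact polyhedron $\mathcal{X} \subseteq \mathbb{R}^L$; a matrix $\boldsymbol{A} \in \mathbb{R}^{L\times K}$, vectors $\boldsymbol{a} \in \mathbb{R}^L$, $\boldsymbol{b} \in \mathbb{R}^K$ and a scalar $b_0 \in \mathbb{R}$ such that $\boldsymbol{A}^\top \boldsymbol{x} \neq \boldsymbol{b}$ for all $\boldsymbol{x} \in \mathcal{X}$; samples $\hat{\boldsymbol{\xi}}_1,\dots,\hat{\boldsymbol{\xi}}_N \in \mathbb{R}^K$; a risk threshold $\varepsilon \in (0,1)$; a radius $\theta \ge 0$; a norm $\|\cdot\|$ on $\mathbb{R}^K$. Write $[N]=\{1,\dots,N\}$ and $(y)^+=\max\{y,0\}$. Safety set: $\mathcal{S}(\boldsymbol{x})=\{\boldsymbol{\xi}\in\mathbb{R}^K : (\boldsymbol{A}\boldsymbol{\xi}+\boldsymbol{a})^\top\boldsymbol{x}<\boldsymbol{b}^\top\boldsymbol{\xi}+b_0\}$; unsafe set: $\bar{\mathcal{S}}(\boldsymbol{x})=\mathbb{R}^K\setminus\mathcal{S}(\boldsymbol{x})$. Wasserstein ball: $\mathcal{F}(\theta) = \{\mathbb{P}\in\mathcal{P}(\mathbb{R}^K) : d_{\rm W}(\mathbb{P},\hat{\mathbb{P}})\le\theta\}$, where $\mathcal{P}(\mathbb{R}^K)$ is the set of probability distributions on $\mathbb{R}^K$, $\hat{\mathbb{P}}=\frac1N\sum_{i=1}^N\delta_{\hat{\boldsymbol{\xi}}_i}$ and $d_{\rm W}(\mathbb{P}_1,\mathbb{P}_2)=\inf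 \mathbb{E}[\|\tilde{\boldsymbol{\xi}}_1-\tilde{\boldsymbol{\xi}}_2\|]$, the infimum being over all joint distributions of $(\tilde{\boldsymbol{\xi}}_1,\tilde{\boldsymbol{\xi}}_2)$ with marginals $\mathbb{P}_1,\mathbb{P}_2$. CVaR: $\mathbb{P}\text{-CVaR}_\varepsilon(\ell(\tilde{\boldsymbol{\xi}}))=\inf\{\tau+\mathbb{E}_{\mathbb{P}}[(\ell(\tilde{\boldsymbol{\xi}})-\tau)^+]/\varepsilon : \tau\in\mathbb{R}\}$. Distances: for a closed set $\mathcal{C}$, $\mathbf{dist}(\boldsymbol{\xi},\mathcal{C})=\min\{\|\boldsymbol{\xi}'-\boldsymbol{\xi}\| : \boldsymbol{\xi}'\in\mathcal{C}\}$; the signed distance is $\mathbf{sgn\text{-}dist}(\boldsymbol{\xi},\mathcal{C})=\mathbf{dist}(\boldsymbol{\xi},\mathcal{C})$ if $\boldsymbol{\xi}\notin\mathcal{C}$ and $\mathbf{sgn\text{-}dist}(\boldsymbol{\xi},\mathcal{C})=-\mathbf{dist}(\boldsymbol{\xi},\mathrm{bd}(\mathcal{C}))$ otherwise, where $\mathrm{bd}(\mathcal{C})$ is the boundary of $\mathcal{C}$. Fractional partial sums: for a possibly fractional $\ell\in[0,N]$, $\sum_{i=1}^{\ell}k_i=\sum_{i=1}^{\lfloor\ell\rfloor}k_i+(\ell-\lfloor\ell\rfloor)k_{\lfloor\ell\rfloor+1}$. *)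

(* Defs.v *)
From HB Require Import structures.
From mathcomp Require Import all_boot all_order all_algebra all_fingroup.
From mathcomp Require Import all_classical all_reals all_analysis.

Set Implicit Arguments.
Unset Strict Implicit.
Unset Printing Implicit Defensive.

Import Order.TTheory GRing.Theory Num.Theory.
Import numFieldNormedType.Exports.

Local Open Scope classical_set_scope.
Local Open Scope ring_scope.

Definition dot {R : realType} {n : nat} (u v : 'cV[R]_n) : R :=
  (u^T *m v) ord0 ord0.

Definition polyhedron {R : realType} {n : nat} (X : set 'cV[R]_n) : Prop :=
  exists (m : nat) (G : 'M[R]_(m, n)) (h : 'cV[R]_m),
    X = [set x | forall i, (G *m x) i ord0 <= h i ord0].

Record is_norm {R : realType} {n : nat} (nrm : 'cV[R]_n -> R) : Prop := IsNorm {
  norm_triangle : forall u v, nrm (u + v) <= nrm u + nrm v ;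
  norm_homog : forall (c : R) u, nrm (c *: u) = `|c| * nrm u ;
  norm_definite : forall u, nrm u = 0 -> u = 0
}.

Section euclidean_space.
Context {R : realType} {n : nat}.
Implicit Types (nrm : 'cV[R]_n -> R) (xi : 'cV[R]_n) (C : set 'cV[R]_n).

(* The topology of 'cV[R]_n is the entrywise one, which is that of every norm. *)
Definition boundary C : set 'cV[R]_n := closure C `\` interior C.

(* For nonempty closed C the infimum is attained; for C = set0 the value is the
   junk inf set0 = 0. *)
Definition dist nrm xi C : R := inf [set nrm (xi' - xi) | xi' in C].

Definition sgn_dist nrm xi C : R :=
  if xi \in C then - dist nrm xi (boundary C) else dist nrm xi C.

End euclidean_space.

(* R^n with its Borel sigma-algebra. *)
Definition borel (R : realType) (n : nat) :=
  g_sigma_algebraType (@open 'cV[R]_n).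

Section distributions.
Context {R : realType} {n : nat}.
Local Notation T := (borel R n).
Local Open Scope ereal_scope.

Definition empirical {N : nat} (xi : 'I_N -> 'cV[R]_n) (A : set T) : \bar R :=
  (N%:R^-1)%:E * \sum_(i < N) \d_(xi i : T) A.

Section empirical_measure.
Context {N : nat} (xi : 'I_N -> 'cV[R]_n).

Let diracs (k : nat) : {measure set T -> \bar R} :=
  \d_(nth 0%R [seq xi i | i <- enum 'I_N] k : T).

Let Ninv_ge0 : (0 <= (N%:R : R)^-1)%R. Proof. by rewrite invr_ge0. Qed.

Let empiricalE : empirical xi = mscale (NngNum Ninv_ge0) (msum diracs N).
Proof.
apply/funext => A; rewrite /empirical /mscale /msum /=; congr (_ * _).
apply: eq_bigr => i _; rewrite /diracs (nth_map i) ?size_enum_ord//.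
by rewrite nth_ord_enum.
Qed.

Let empirical0 : empirical xi set0 = 0.
Proof. by rewrite empiricalE measure0. Qed.

Let empirical_ge0 A : 0 <= empirical xi A.
Proof. by rewrite empiricalE measure_ge0. Qed.

Let empirical_sigma_additive : semi_sigma_additive (empirical xi).
Proof. by rewrite empiricalE; exact: measure_semi_sigma_additive. Qed.

HB.instance Definition _ := isMeasure.Build _ T R (empirical xi)
  empirical0 empirical_ge0 empirical_sigma_additive.

Lemma empirical_setT : (0 < N)%N -> empirical xi [set: T] = 1.
Proof.
move=> N0; rewrite /empirical (eq_bigr (fun=> 1)) => [|i _]; last first.
  by rewrite diracT.
rewrite sumEFin sumr_const card_ord -EFinM mulVf//.
by rewrite pnatr_eq0 -lt0n.
Qed.

End empirical_measure.

(* The Borel sigma-algebra of R^n x R^n is the product of those of the factors,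
   so the joint distributions are the probabilities on the product type. *)
Definition couplings (mu1 mu2 : {measure set T -> \bar R}) :
    set (probability (T * T)%type R) :=
  [set G : probability (T * T)%type R | forall A : set T, measurable A ->
     pushforward G fst A = mu1 A /\ pushforward G snd A = mu2 A].

Definition wasserstein (nrm : 'cV[R]_n -> R)
    (mu1 mu2 : {measure set T -> \bar R}) : \bar R :=
  ereal_inf [set 'E_G[fun z => nrm ((z.1 : 'cV[R]_n) - z.2)%R]
            | G in couplings mu1 mu2].

Definition wasserstein_ball (nrm : 'cV[R]_n -> R) {N : nat}
    (xi : 'I_N -> 'cV[R]_n) (theta : R) : set (probability T R) :=
  [set P : probability T R | wasserstein nrm P (empirical xi) <= theta%:E].

(* The expectation of the nonnegative excess may be +oo, so the value lives in
   \bar R. *)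
Definition cvar (P : probability T R) (eps : R) (loss : 'cV[R]_n -> R) :
    \bar R :=
  ereal_inf [set tau%:E
                 + 'E_P[fun xi => Num.max (loss xi - tau)%R 0%R] * (eps^-1)%:E
            | tau in [set: R]].

End distributions.

Definition safety_set {R : realType} {L K : nat} (A : 'M[R]_(L, K))
    (a : 'cV[R]_L) (b : 'cV[R]_K) (b0 : R) (x : 'cV[R]_L) : set 'cV[R]_K :=
  [set xi | dot (A *m xi + a) x < dot b xi + b0].

Definition unsafe_set {R : realType} {L K : nat} (A : 'M[R]_(L, K))
    (a : 'cV[R]_L) (b : 'cV[R]_K) (b0 : R) (x : 'cV[R]_L) : set 'cV[R]_K :=
  ~` safety_set A a b b0 x.

(* The terms k_1, ..., k_N are k`_0, ..., k`_(N-1). For 0 <= l <= N the default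
   value of nth occurs only at l = N, with coefficient 0. *)
Definition frac_sum {R : realType} (l : R) (k : seq R) : R :=
  \sum_(i < Num.truncn l) k`_i
  + (l - (Num.truncn l)%:R) * k`_(Num.truncn l).

(* Main.v *)
Require Import Defs.
From HB Require Import structures.
From mathcomp Require Import all_boot all_order all_algebra all_fingroup.
From mathcomp Require Import all_classical all_reals all_analysis.
From mathcomp Require Import measurable_realfun simple_functions ring lra.

(** The loss is the affine function [d + dot c xi] with [c = A^T x - b != 0] and
    [d = dot a x - b0], and the unsafe set is the half-space where it is
    nonnegative.  Two facts give the equivalence.

    Distances to a half-space are rescaled losses.  By compactness there is a
    direction [v0] with [dot c v0 = 1] of least norm [r]; so [1 / r] is the dual
    norm of [c], and it is attained ([exists_support_point]).  Moving along [v0]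
    is the cheapest way to change the loss, whence the signed distance of [xi]
    to the unsafe set is [- r * loss xi] ([sgn_dist_halfspace]).

    The worst-case CVaR over the Wasserstein ball has a closed form
    ([worst_case_cvarE]): it is the CVaR of the empirical distribution, which is
    the average of the eps-fraction of largest losses, plus
    [theta / (r * eps)].
    - It cannot be larger: along a coupling of cost about [theta] the loss,
      being [1 / r]-Lipschitz, and with it the excess over any level [tau],
      grows by about [theta / r] at most in expectation ([cvar_le]); take for
      [tau] the empirical quantile.
    - It is attained: spend the whole budget on the tail, by moving the mass
      [eps] of the worst samples by [(theta / (r * eps)) v0]
      ([cvar_shifted_tail_ge]).

    The closed form is nonpositive exactly when [theta] is at most [- r / N]
    times the sum of the [eps N] largest losses, which is the sum of the [eps N]
    smallest signed distances divided by [N].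

    The transport cost is integrated without establishing that the norm of a
    difference is measurable on the product: its integral is only bounded below
    by that of a measurable minorant ([le_ge0_integral]), and above when the
    coupling is finitely supported ([le_integral_discrete]).  Both bounds hold
    for the lower integral of any nonnegative function. *)

Set Implicit Arguments.
Unset Strict Implicit.
Unset Printing Implicit Defensive.

Import Order.TTheory GRing.Theory Num.Theory.
Import numFieldNormedType.Exports.

Local Open Scope classical_set_scope.
Local Open Scope ring_scope.

(** * Norms on column vectors and their dual norm *)

Section norms.
Context {R : realType} {n : nat}.
Implicit Types (u v c : 'cV[R]_n).

Lemma dotDr c u v : dot c (u + v) = dot c u + dot c v.
Proof. by rewrite /dot mulmxDr mxE. Qed.

Lemma dotZr c (k : R) u : dot c (k *: u) = k * dot c u.
Proof. by rewrite /dot -scalemxAr mxE. Qed.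

Lemma dot0r c : dot c 0 = 0.
Proof. by rewrite /dot mulmx0 mxE. Qed.

Lemma dotNr c u : dot c (- u) = - dot c u.
Proof. by rewrite /dot mulmxN mxE. Qed.

Lemma dotC u v : dot u v = dot v u.
Proof. by rewrite /dot -[in LHS](trmxK v) -trmx_mul mxE. Qed.

Lemma dotE c u : dot c u = \sum_i c i ord0 * u i ord0.
Proof. by rewrite /dot mxE; apply: eq_bigr => i _; rewrite mxE. Qed.

Lemma dot_self_gt0 c : c <> 0 -> 0 < dot c c.
Proof.
move=> c0; rewrite dotE lt_def sumr_ge0 ?andbT => [|i _]; last first.
  by rewrite -expr2 sqr_ge0.
apply/eqP => /psumr_eq0P sc0; apply: c0; apply/colP => i; rewrite mxE.
by apply/eqP; rewrite -sqrf_eq0 expr2 sc0 // => j _; rewrite -expr2 sqr_ge0.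
Qed.

Lemma ler_entry_norm (m p : nat) (M : 'M[R]_(m, p)) i j : `|M i j| <= `|M|.
Proof.
rewrite [leRHS]/Num.norm /= mx_normrE; apply/bigmax_geP; right => /=.
by exists (i, j).
Qed.

Lemma continuous_dot_comp (T : topologicalType) c (g : T -> 'cV[R]_n) :
  (forall i, continuous (fun t => g t i ord0)) ->
  continuous (fun t => dot c (g t)).
Proof.
move=> cg; under eq_fun do rewrite dotE.
apply: continuous_big => [|i _ t]; first exact: add_continuous.
by apply: cvgM; [exact: cvg_cst | exact: cg].
Qed.

Lemma continuous_dot c : continuous (dot c).
Proof.
by apply: (@continuous_dot_comp _ c id) => i; exact: coord_continuous.
Qed.

Variables (nrm : 'cV[R]_n -> R).
Hypothesis nrmP : is_norm nrm.

Lemma is_norm0 : nrm 0 = 0.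
Proof. by rewrite -(scale0r 0) (norm_homog nrmP) normr0 mul0r. Qed.

Lemma is_normN u : nrm (- u) = nrm u.
Proof. by rewrite -scaleN1r (norm_homog nrmP) normrN1 mul1r. Qed.

Lemma is_norm_ge0 u : 0 <= nrm u.
Proof.
have := norm_triangle nrmP u (- u).
by rewrite subrr is_norm0 is_normN -mulr2n pmulrn_lge0.
Qed.

Lemma is_norm_gt0 u : u <> 0 -> 0 < nrm u.
Proof.
move=> u0; rewrite lt_def is_norm_ge0 andbT.
by apply/eqP => /(norm_definite nrmP).
Qed.

Lemma is_norm_sum (I : Type) (s : seq I) (F : I -> 'cV[R]_n) :
  nrm (\sum_(i <- s) F i) <= \sum_(i <- s) nrm (F i).
Proof.
elim/big_ind2: _ => [|u x v y ux vy|i _ //]; first by rewrite is_norm0.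
exact: le_trans (norm_triangle nrmP _ _) (lerD ux vy).
Qed.

Lemma is_norm_dist u v : `|nrm u - nrm v| <= nrm (u - v).
Proof.
have le_sub x y : nrm x - nrm y <= nrm (x - y).
  by rewrite lerBlDr -{1}(subrK y x); exact: norm_triangle.
by rewrite ler_norml le_sub andbT lerNl opprB -(is_normN (u - v)) opprB le_sub.
Qed.

(** Expand [u] in the standard basis: this is what makes an arbitrary norm
    continuous for the entrywise topology. *)
Lemma is_norm_le_sup :
  exists2 C : R, 0 < C & forall u : 'rV[R]_n, nrm u^T <= C * `|u|.
Proof.
pose C := \sum_(j < n) nrm (delta_mx j ord0).
have C0 : 0 <= C by apply: sumr_ge0 => j _; exact: is_norm_ge0.
exists (C + 1) => [|u]; first by rewrite ltr_wpDl.
apply: (@le_trans _ _ (C * `|u|)); last first.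
  by rewrite ler_wpM2r // lerDl.
rewrite [u^T in leLHS]matrix_sum_delta.
under eq_bigr do rewrite big_ord1.
apply: (le_trans (is_norm_sum _ _)); rewrite mulr_suml; apply: ler_sum => j _.
rewrite (norm_homog nrmP) mulrC ler_wpM2l ?is_norm_ge0 // mxE.
exact: ler_entry_norm.
Qed.

Lemma continuous_is_norm_tr : continuous (fun u : 'rV[R]_n => nrm u^T).
Proof.
have [C C0 nrmC] := is_norm_le_sup.
move=> u; apply/(@cvgrPdist_lt _ _ _ (nbhs u) (nbhs_filter u)) => e e0.
suff: nbhs u [set v | `|nrm u^T - nrm v^T| < e] by [].
apply/nbhs_ballP; exists (e / C) => [|v]; first exact: divr_gt0.
rewrite mx_norm_ball /ball_ /= => uv.
apply: (le_lt_trans (is_norm_dist _ _)); rewrite -linearB /=.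
by apply: (le_lt_trans (nrmC _)); rewrite mulrC -ltr_pdivlMr.
Qed.

(** The dual norm of [c] is the maximum of [`|dot c u| / nrm u], which is constant
    on lines and hence may be maximized over the compact unit sphere of the sup
    norm.  Rescaling a maximizer to [dot c v0 = 1] gives [v0], and [1 / nrm v0]
    is the dual norm. *)
Lemma exists_support_point c : c <> 0 ->
  exists v0, [/\ dot c v0 = 1, 0 < nrm v0
               & forall u, nrm v0 * `|dot c u| <= nrm u].
Proof.
move=> c0.
pose f (u : 'rV[R]_n) := `|dot c u^T| / nrm u^T.
pose S : set 'rV[R]_n := [set u | `|u| = 1].
have cT0 : c^T <> 0 by move=> /(congr1 trmx); rewrite trmxK trmx0.
have normz (u : 'rV[R]_n) : u <> 0 -> S (`|u|^-1 *: u).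
  move=> /eqP; rewrite -normr_eq0 => u0.
  by rewrite /S /= normrZ normfV normr_id mulVf.
have S0 : S !=set0 by exists (`|c^T|^-1 *: c^T); exact: normz.
have Sn0 (u : 'rV[R]_n) : S u -> u^T <> 0.
  move=> + /(congr1 trmx); rewrite trmxK trmx0 => + u0.
  by rewrite /S /= u0 normr0 => /esym/eqP; rewrite oner_eq0.
have Sc : compact S.
  apply: bounded_closed_compact.
    by exists 1; split => // x x1 u /= ->; exact: ltW.
  apply: (@preimage_closed _ _ (fun u : 'rV[R]_n => `|u|) [set 1]).
    move=> u _; exact: norm_continuous.
  exact: closed_eq.
have cdot : continuous (fun u : 'rV[R]_n => dot c u^T).
  apply: continuous_dot_comp => i; under eq_fun do rewrite mxE.
  exact: coord_continuous.
have cf : {within S, continuous f}.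
  apply: continuous_in_subspaceT => u /set_mem Su.
  have cn : {for u, continuous (fun v : 'rV[R]_n => `|dot c v^T|)}.
    by apply: continuous_comp; [exact: cdot | exact: norm_continuous].
  have ci : {for u, continuous (fun v : 'rV[R]_n => (nrm v^T)^-1)}.
    apply: continuousV; last exact: continuous_is_norm_tr.
    by rewrite gt_eqF // is_norm_gt0 //; exact: Sn0.
  exact: continuousM cn ci.
have [u0 /set_mem Su0 maxf] := EVT_max_rV S0 Sc cf.
have fscale k (u : 'rV[R]_n) : k != 0 -> f (k *: u) = f u.
  move=> k0; rewrite /f linearZ /= dotZr (norm_homog nrmP) normrM.
  by rewrite invfM mulrACA divff ?normr_eq0 // mul1r.
have maxf' (u : 'rV[R]_n) : u <> 0 -> f u <= f u0.
  move=> u_neq0; rewrite -(@fscale (`|u|^-1)).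
    by apply: maxf; apply/mem_set; exact: normz.
  by rewrite invr_eq0 normr_eq0; exact/eqP.
have nu0 : 0 < nrm u0^T by apply: is_norm_gt0; exact: Sn0.
have cu0 : 0 < `|dot c u0^T|.
  have : 0 < f u0.
    apply: lt_le_trans (maxf' _ cT0); rewrite /f trmxK divr_gt0 ?is_norm_gt0 //.
    by rewrite normr_gt0 gt_eqF // dot_self_gt0.
  by rewrite /f pmulr_lgt0 // invr_gt0.
have cu0' : dot c u0^T != 0 by rewrite -normr_gt0.
exists ((dot c u0^T)^-1 *: u0^T); split.
- by rewrite dotZr mulVf.
- by rewrite (norm_homog nrmP) mulr_gt0 // normr_gt0 invr_eq0.
move=> u; have [->|/eqP u_neq0] := eqVneq u 0.
  by rewrite dot0r normr0 mulr0 is_norm0.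
rewrite (norm_homog nrmP) normfV.
have := maxf' u^T; rewrite /f trmxK => /(_ _)/wrap[].
  by move=> /(congr1 trmx); rewrite trmxK trmx0.
rewrite ler_pdivrMr ?is_norm_gt0 // mulrAC ler_pdivlMr // => le_u.
by rewrite -mulrA ler_pdivrMl // mulrC.
Qed.

End norms.

(** * Signed distances to a half-space *)

Section halfspace.
Context {R : realType} {n : nat}.
Variables (nrm : 'cV[R]_n -> R) (c v0 : 'cV[R]_n) (d : R).
Hypothesis nrmP : is_norm nrm.
Hypothesis cv0 : dot c v0 = 1.
Hypothesis v0_min : forall u, nrm v0 * `|dot c u| <= nrm u.

Let loss (xi : 'cV[R]_n) : R := d + dot c xi.

Lemma inf_attained (S : set R) m : S m -> lbound S m -> inf S = m.
Proof.
move=> Sm mS; apply/eqP; rewrite eq_le; apply/andP; split.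
  by apply: ge_inf => //; exists m.
by apply: lb_le_inf => //; exists m.
Qed.

Let lossD xi u : loss (xi + u) = loss xi + dot c u.
Proof. by rewrite /loss dotDr addrA. Qed.

(** The bound [v0_min] makes it at least [nrm v0 * `|loss xi|] costly to reach the
    level set [loss = 0], and sliding along [v0] achieves this cost.  Covers both
    the half-space seen from outside and its boundary. *)
Lemma dist_halfspace (C : set 'cV[R]_n) xi :
  (forall xi', loss xi' = 0 -> C xi') ->
  (forall xi', C xi' -> `|loss xi| <= `|loss xi' - loss xi|) ->
  dist nrm xi C = nrm v0 * `|loss xi|.
Proof.
move=> C0 Cfar; apply: inf_attained.
  exists (xi + - loss xi *: v0).
    by apply: C0; rewrite lossD dotZr cv0 mulr1 subrr.
  by rewrite addrC addKr (norm_homog nrmP) normrN mulrC.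
move=> _ [xi' Cxi' <-].
apply: le_trans (v0_min _); apply: ler_wpM2l; first exact: is_norm_ge0.
apply: le_trans (Cfar _ Cxi') _.
by rewrite -{1}(subrK xi xi') [X in loss X]addrC lossD addrC addKr.
Qed.

(** A point at level [0] is not interior since a small step along [- v0], which
    lowers the loss, leaves the half-space. *)
Lemma boundary_halfspace :
  boundary [set xi | 0 <= loss xi] = [set xi | loss xi = 0].
Proof.
have closs : continuous loss.
  move=> u; apply: continuousD; [exact: cst_continuous|exact: continuous_dot].
have clU : closed [set xi | 0 <= loss xi].
  apply: (@preimage_closed _ _ loss [set y | 0 <= y]).
    by move=> u _; exact: closs.
  exact: closed_ge.
apply/seteqP; split=> xi; rewrite /boundary -(closure_id _).1 //=.
  move=> [loss0 nint]; apply/eqP; rewrite eq_le loss0 andbT leNgt.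
  apply/negP => loss_gt0; apply: nint.
  have : nbhs xi (loss @^-1` [set y | 0 < y]).
    by apply: closs; apply: open_nbhs_nbhs; split => //; exact: open_gt.
  by apply: filterS => u /= /ltW.
move=> loss0; split; first by rewrite loss0.
rewrite /interior /= => nU.
have [e /= e0] := (nbhs_ballP _ _).1 nU.
rewrite mx_norm_ball /ball_ /= => ballU.
(* short enough for the step to have length less than [e] *)
pose t := e / (`|v0| + 1).
have v01 : 0 < `|v0| + 1 by rewrite ltr_wpDl.
have t0 : 0 < t by exact: divr_gt0.
have := ballU (xi - t *: v0); rewrite /= opprB addrC subrK => /(_ _)/wrap[].
  by rewrite normrZ gtr0_norm // mulrAC ltr_pdivrMr // ltr_pM2l // ltrDl.
by rewrite -scaleNr lossD loss0 add0r dotZr cv0 mulr1 oppr_ge0 leNgt t0.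
Qed.

Lemma sgn_dist_halfspace xi :
  sgn_dist nrm xi [set xi | 0 <= loss xi] = - (nrm v0 * loss xi).
Proof.
rewrite /sgn_dist; case: ifPn => [/set_mem /= loss_ge0|].
  rewrite boundary_halfspace dist_halfspace ?ger0_norm // => xi' /= ->.
  by rewrite sub0r normrN ler_norm.
move=> /negP nU; have {}nU : loss xi < 0.
  by rewrite ltNge; apply/negP => le0; apply: nU; apply/mem_set.
rewrite dist_halfspace ?ltr0_norm ?mulrN // => [xi' /= -> //|xi' /= loss_ge0].
by rewrite ger0_norm ?subr_ge0 ?(le_trans (ltW nU)) // lerDr.
Qed.

End halfspace.

Lemma unsafe_halfspace {R : realType} {L K : nat} (A : 'M[R]_(L, K))
    (a : 'cV[R]_L) (b : 'cV[R]_K) (b0 : R) (x : 'cV[R]_L) :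
  unsafe_set A a b b0 x =
  [set xi | 0 <= dot a x - b0 + dot (A^T *m x - b) xi].
Proof.
have E xi : dot a x - b0 + dot (A^T *m x - b) xi
            = dot (A *m xi + a) x - (dot b xi + b0).
  rewrite (dotC (_ - b)) dotDr dotNr (dotC xi b).
  rewrite (dotC (_ + a)) dotDr (dotC x a).
  have -> : dot x (A *m xi) = dot xi (A^T *m x).
    by rewrite dotC /dot trmx_mul mulmxA.
  ring.
apply/seteqP; split=> xi; rewrite /unsafe_set /safety_set /= E subr_ge0 leNgt.
  by move=> /negP.
by move=> /negP.
Qed.

(** * Finitely supported measures and lower integrals *)

Section discrete_measures.
Context d (T : measurableType d) (R : realType) (I : Type).
Variables (s : seq I) (w : I -> R) (z : I -> T).
Hypothesis w_ge0 : forall i, 0 <= w i.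
Local Open Scope ereal_scope.

(** The integral formula is proved together with the existence, by induction on
    [s]; [integral_discrete] then transfers it to every measure with the same
    values. *)
Lemma exists_discrete_measure : exists mu : {measure set T -> \bar R},
  (forall A, mu A = \sum_(i <- s) (w i)%:E * \d_(z i) A) /\
  (forall f : T -> \bar R, measurable_fun [set: T] f -> (forall t, 0 <= f t) ->
     \int[mu]_t f t = \sum_(i <- s) (w i)%:E * f (z i)).
Proof.
elim: s => [|i l [mu [muE intmu]]].
  exists mzero; split => [A|f _ _]; first by rewrite big_nil.
  by rewrite integral_measure_zero big_nil.
exists (measure_add (mscale (NngNum (w_ge0 i)) (\d_(z i))) mu).
split => [A|f mf f0]; first by rewrite [LHS]measure_addE muE big_cons.
rewrite ge0_integral_measure_add // intmu // ge0_integral_mscale //.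
by rewrite integral_dirac // diracT mul1e big_cons.
Qed.

Lemma integral_discrete (mu : {measure set T -> \bar R}) (f : T -> \bar R) :
  (forall A, measurable A -> mu A = \sum_(i <- s) (w i)%:E * \d_(z i) A) ->
  measurable_fun [set: T] f -> (forall t, 0 <= f t) ->
  \int[mu]_t f t = \sum_(i <- s) (w i)%:E * f (z i).
Proof.
move=> muE mf f0; have [nu [nuE intnu]] := exists_discrete_measure.
rewrite -intnu //; apply: eq_measure_integral => A mA _.
by rewrite muE // -nuE.
Qed.

Import HBNNSimple.

(** Every simple function below [f] is integrated by its values at the atoms, where
    it lies below [f]; the supremum of these integrals is the integral of [f]. *)
Lemma le_integral_discrete (mu : {measure set T -> \bar R}) (f : T -> \bar R) :
  (forall A, measurable A -> mu A = \sum_(i <- s) (w i)%:E * \d_(z i) A) ->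
  (forall t, 0 <= f t) ->
  \int[mu]_t f t <= \sum_(i <- s) (w i)%:E * f (z i).
Proof.
move=> muE f0; rewrite ge0_integralTE //.
apply: ge_ereal_sup => _ /= [h hf <-].
rewrite -integralT_nnsfun integral_discrete //.
- by apply: lee_sum => i _; apply: lee_wpmul2l; rewrite ?lee_fin.
- by apply/measurable_EFinP.
- by move=> t; rewrite lee_fin; exact: fun_ge0.
Qed.

Lemma exists_discrete_probability : (\sum_(i <- s) w i = 1)%R ->
  exists P : probability T R,
    forall A, P A = \sum_(i <- s) (w i)%:E * \d_(z i) A.
Proof.
move=> w1; have [mu [muE _]] := exists_discrete_measure.
have muT : mu [set: T] = 1.
  rewrite muE; under eq_bigr do rewrite diracT mule1.
  by rewrite sumEFin w1.
case: s w1 muE => [|i l] w1 muE; last first.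
  (* normalizing a measure of total mass 1 leaves it unchanged *)
  exists (mnormalize mu (\d_(z i))) => A; rewrite -muE.
  by rewrite /reverse_coercion /= /mnormalize muT onee_eq0 /= invr1 mule1.
by move: w1; rewrite big_nil => /esym/eqP; rewrite oner_eq0.
Qed.

End discrete_measures.

Section integral_minorant.
Context d (T : measurableType d) (R : realType).
Local Open Scope ereal_scope.
Import HBNNSimple.

(** Monotonicity without measurability: the integral of a nonnegative function is
    the supremum over the simple functions below it. *)
Lemma le_ge0_integral (mu : {measure set T -> \bar R}) (f g : T -> \bar R) :
  (forall t, 0 <= f t) -> (forall t, f t <= g t) ->
  \int[mu]_t f t <= \int[mu]_t g t.
Proof.
move=> f0 fg; rewrite !ge0_integralTE //; last first.
  by move=> t; exact: le_trans (fg t).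
apply: ereal_sup_le => _ /= [h hf <-]; exists h => // t.
exact: le_trans (fg t).
Qed.

End integral_minorant.

Section borel_measurability.
Context {R : realType} {n : nat}.

Lemma measurable_continuous_borel (f : 'cV[R]_n -> R) :
  continuous f -> measurable_fun [set: borel R n] (f : borel R n -> R).
Proof.
move=> cf; apply: (measurability _ (RGenOpens.measurableE R)).
move=> _ [_ [a [b ->] <-]]; rewrite setTI; apply: sub_sigma_algebra.
by apply: open_comp => [u _|]; [exact: cf|exact: interval_open].
Qed.

Lemma empirical_discrete {N : nat} (xi : 'I_N -> 'cV[R]_n)
    (A : set (borel R n)) :
  empirical xi A = (\sum_(i < N) (N%:R^-1)%:E * \d_(xi i : borel R n) A)%E.
Proof. by rewrite /empirical ge0_sume_distrr. Qed.

End borel_measurability.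

(** * Fractional partial sums as weighted sums *)

Section fractional_sums.
Context {R : realType}.
Implicit Types (l : R) (k : nat).

(** The share of the [k]-th term in a fractional partial sum of length [l]; the
    same weights describe which part of each atom lies in the tail. *)
Definition frac_weight l k : R :=
  if (k < Num.truncn l)%N then 1
  else if k == Num.truncn l then l - (Num.truncn l)%:R else 0.

Lemma frac_weight_ge0 l k : 0 <= l -> 0 <= frac_weight l k.
Proof.
move=> l0; rewrite /frac_weight; case: ifP => // _; case: ifP => // _.
by rewrite subr_ge0 truncn_le.
Qed.

Lemma frac_weight_le1 l k : 0 <= l -> frac_weight l k <= 1.
Proof.
move=> l0; rewrite /frac_weight; case: ifP => // _; case: ifP => // _.
by rewrite lerBlDr nat1r ltW // truncnS_gt.
Qed.

Lemma truncn_ltn l N : 0 <= l -> l < N%:R -> (Num.truncn l < N)%N.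
Proof.
by move=> l0 lN; rewrite -(ltr_nat R) (le_lt_trans _ lN) // truncn_le.
Qed.

Lemma frac_sum_weight l N (f : 'I_N -> R) : 0 <= l -> l < N%:R ->
  frac_sum l [seq f i | i <- enum 'I_N] = \sum_(i < N) frac_weight l i * f i.
Proof.
move=> l0 lN; have mN := truncn_ltn l0 lN.
set s := [seq _ | _ <- _].
have -> : \sum_(i < N) frac_weight l i * f i
        = \sum_(0 <= i < N) frac_weight l i * s`_i.
  rewrite big_mkord; apply: eq_bigr => i _; congr (_ * _).
  by rewrite /s (nth_map i) ?size_enum_ord // nth_ord_enum.
rewrite /frac_sum (@big_cat_nat _ _ _ (Num.truncn l)) //=; last exact: ltnW.
rewrite big_mkord; congr (_ + _).
  by apply: eq_bigr => i _; rewrite /frac_weight ltn_ord mul1r.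
rewrite big_ltn // {1}/frac_weight ltnn eqxx big_nat big1 ?addr0 // => i.
move=> /andP[mi _]; rewrite /frac_weight ltnNge (ltnW mi) /=.
by rewrite gtn_eqF // mul0r.
Qed.

Lemma sum_frac_weight l N : 0 <= l -> l < N%:R ->
  \sum_(i < N) frac_weight l i = l.
Proof.
move=> l0 lN; have := frac_sum_weight (fun=> 1) l0 lN.
under [in RHS]eq_bigr do rewrite mulr1.
move=> <-; rewrite /frac_sum (nth_map (Ordinal (truncn_ltn l0 lN))); last first.
  by rewrite size_enum_ord truncn_ltn.
rewrite (eq_bigr (fun=> 1)) => [|i _]; last first.
  rewrite (nth_map (Ordinal (truncn_ltn l0 lN))) // size_enum_ord.
  by rewrite (ltn_trans (ltn_ord i)) // truncn_ltn.
by rewrite sumr_const card_ord mulr1 subrKC.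
Qed.

(** The level [tau] is the value of rank [truncn l], i.e. the value at risk: the
    terms counted fully lie above it, those not counted lie below it, and the
    one with the fractional weight equals it, so that both sides vanish there. *)
Lemma frac_weight_excess l N (f : 'I_N -> R) :
  0 <= l -> l < N%:R -> (forall i j : 'I_N, (i <= j)%N -> f j <= f i) ->
  exists tau, forall i : 'I_N,
    Num.max (f i - tau) 0 = frac_weight l i * (f i - tau).
Proof.
move=> l0 lN f_noninc; pose m := Ordinal (truncn_ltn l0 lN).
exists (f m) => i; rewrite /frac_weight; case: ltngtP => [im|mi|im].
- rewrite mul1r; apply/max_idPl; rewrite subr_ge0.
  by apply: f_noninc; exact: ltnW.
- rewrite mul0r; apply/max_idPr; rewrite subr_le0.
  by apply: f_noninc; exact: ltnW.
- have -> : i = m by exact: val_inj.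
  by rewrite subrr maxxx mulr0.
Qed.

End fractional_sums.

(** * Bounds on the CVaR over the Wasserstein ball *)

Lemma expectation_integral d (T : measurableType d) (R : realType)
  (P : probability T R) (X : T -> R) : ('E_P[X] = \int[P]_t (X t)%:E)%E.
Proof. by rewrite unlock. Qed.

Section worst_case_cvar.
Context {R : realType} {n N : nat}.
Variables (nrm : 'cV[R]_n -> R) (xi : 'I_N -> 'cV[R]_n) (loss : 'cV[R]_n -> R).
Variables (eps theta r : R).
Hypotheses (nrmP : is_norm nrm) (N_gt0 : (0 < N)%N).
Hypotheses (eps_gt0 : 0 < eps) (r_gt0 : 0 < r).
Hypothesis loss_cont : continuous loss.
Hypothesis loss_lip : forall u v, r * `|loss u - loss v| <= nrm (u - v).

Local Notation T := (borel R n).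
Let excess (tau : R) (u : T) : R := Num.max (loss u - tau) 0.

Let mloss : measurable_fun [set: T] (loss : T -> R).
Proof. exact: measurable_continuous_borel. Qed.

Let mexcess tau : measurable_fun [set: T] (excess tau).
Proof.
apply: measurable_maxr; last exact: measurable_cst.
by apply: measurable_funB => //; exact: measurable_cst.
Qed.

Let mexcessE tau : measurable_fun [set: T] (fun u => (excess tau u)%:E).
Proof. by apply/measurable_EFinP; exact: mexcess. Qed.

Let excess_ge0 tau u : 0 <= excess tau u.
Proof. by rewrite /excess le_max lexx orbT. Qed.

Let excess_lip tau u v : excess tau u <= excess tau v + `|loss u - loss v|.
Proof.
rewrite /excess ge_max; apply/andP; split; last first.
  by rewrite addr_ge0 // le_max lexx orbT.
have : loss v - tau <= Num.max (loss v - tau) 0 by rewrite le_max lexx.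
have := ler_norm (loss u - loss v); lra.
Qed.

(** Transport the excess along a coupling of cost less than [theta + r * e]: its
    increase is at most the gap [`|loss z.1 - loss z.2|], a measurable function
    below [1 / r] times the cost. *)
Lemma expected_excess_le (P : probability T R) tau :
  wasserstein_ball nrm xi theta P ->
  ('E_P[excess tau]
     <= (N%:R^-1 * \sum_(i < N) excess tau (xi i) + theta / r)%:E)%E.
Proof.
move=> Pball; apply/lee_addgt0Pr => e e0.
have : (wasserstein nrm P (empirical xi) < (theta + r * e)%:E)%E.
  by apply: le_lt_trans Pball _; rewrite lte_fin ltrDl mulr_gt0.
move=> /ereal_inf_lt[_ [G GP <-]]; rewrite !expectation_integral => costG.
have -> : (\int[P]_u (excess tau u)%:E = \int[G]_z (excess tau z.1)%:E)%E.
  have -> : (\int[P]_u (excess tau u)%:E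
             = \int[pushforward G fst]_u (excess tau u)%:E)%E.
    by apply: eq_measure_integral => A mA _; rewrite -(GP A mA).1.
  rewrite ge0_integral_pushforward //.
  by move=> u _; rewrite lee_fin.
have empG : (\int[G]_z (excess tau z.2)%:E
             = (N%:R^-1 * \sum_(i < N) excess tau (xi i))%:E)%E.
  transitivity (\int[pushforward G snd]_u (excess tau u)%:E)%E.
    rewrite ge0_integral_pushforward //.
    by move=> u _; rewrite lee_fin.
  rewrite (@integral_discrete _ _ _ _ (index_enum 'I_N) (fun=> N%:R^-1)
    (xi : 'I_N -> T)) //.
  - rewrite mulr_sumr -sumEFin; apply: eq_bigr => i _.
    by rewrite EFinM.
  - by move=> A mA; rewrite -empirical_discrete; exact: (GP A mA).2.
  - by move=> u; rewrite lee_fin.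
pose gap (z : T * T) := `|loss z.1 - loss z.2|.
have gap_ge0 z : 0 <= gap z by exact: normr_ge0.
have mgap : measurable_fun [set: T * T] gap.
  apply: measurableT_comp => //; apply: measurable_funB.
    by apply: measurableT_comp mloss _; exact: measurable_fst.
  by apply: measurableT_comp mloss _; exact: measurable_snd.
have gapG : (\int[G]_z (gap z)%:E <= (theta / r + e)%:E)%E.
  have : (r%:E * \int[G]_z (gap z)%:E <= (theta + r * e)%:E)%E.
    rewrite -ge0_integralZl //; last 3 first.
    - by apply/measurable_EFinP.
    - by move=> z _; rewrite lee_fin.
    - by rewrite lee_fin ltW.
    apply: le_trans (ltW costG); apply: le_ge0_integral => z.
      by rewrite -EFinM lee_fin mulr_ge0 // ltW.
    by rewrite -EFinM lee_fin; exact: loss_lip.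
  rewrite -lee_pdivlMl // => /le_trans; apply; rewrite -EFinM lee_fin.
  by rewrite mulrDr mulrA mulVf ?gt_eqF // mul1r mulrC.
apply: (@le_trans _ _ (\int[G]_z ((excess tau z.2)%:E + (gap z)%:E))%E).
  apply: le_ge0_integral => z; first by rewrite lee_fin.
  by rewrite -EFinD lee_fin; exact: excess_lip.
rewrite ge0_integralD //.
- by rewrite empG -EFinD -addrA EFinD; apply: leeD2l.
- by move=> z _; rewrite lee_fin.
- apply/measurable_EFinP; apply: measurableT_comp (mexcess tau) _.
  exact: measurable_snd.
- by move=> z _; rewrite lee_fin.
- by apply/measurable_EFinP.
Qed.

Lemma cvar_le (P : probability T R) tau :
  wasserstein_ball nrm xi theta P ->
  (cvar P eps loss
     <= (tau + (N%:R^-1 * \sum_(i < N) excess tau (xi i) + theta / r)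
               / eps)%:E)%E.
Proof.
move=> Pball; apply: (@le_trans _ _ (tau%:E + 'E_P[excess tau] * eps^-1%:E)%E).
  by apply: ereal_inf_lbound; exists tau.
rewrite EFinD EFinM; apply: leeD2l; apply: lee_wpmul2r.
  by rewrite lee_fin invr_ge0 ltW.
exact: expected_excess_le.
Qed.

Section shifted_tail.
Variables (w : 'I_N -> R) (u : 'cV[R]_n).
Hypotheses (w_ge0 : forall i, 0 <= w i) (w_le1 : forall i, w i <= 1).
Hypothesis w_sum : \sum_(i < N) w i = eps * N%:R.
Hypothesis u_cost : eps * nrm u <= theta.

(* Each sample is split into a part of relative weight [w i], moved by [u], and a
   part of relative weight [1 - w i] that stays. *)
Let idx := ('I_N * bool)%type.
Let mass (p : idx) : R := N%:R^-1 * (if p.2 then w p.1 else 1 - w p.1).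
Let moved (p : idx) : T := if p.2 then xi p.1 + u else xi p.1.

Let mass_ge0 p : 0 <= mass p.
Proof.
by rewrite /mass mulr_ge0 // ?invr_ge0 //; case: ifP => // _; rewrite subr_ge0.
Qed.

Let N_neq0 : N%:R != 0 :> R.
Proof. by rewrite pnatr_eq0 -lt0n. Qed.

Let sum_idx (V : nmodType) (F : idx -> V) :
  \sum_p F p = \sum_(i < N) (F (i, true) + F (i, false)).
Proof.
rewrite (eq_bigr (fun p : idx => F (p.1, p.2))) => [|[]//].
rewrite -(pair_bigA _ (fun i b => F (i, b))) /=.
by apply: eq_bigr => i _; rewrite big_bool.
Qed.

Let mass_sum : \sum_p mass p = 1.
Proof.
rewrite sum_idx (eq_bigr (fun=> N%:R^-1)) => [|i _]; last first.
  by rewrite /mass /= -mulrDr subrKC mulr1.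
by rewrite sumr_const card_ord -[LHS]mulr_natr mulVf.
Qed.

(** Couple each part of a sample with the sample it comes from; only the moved
    parts, of total mass [eps], have a cost, and it is [nrm u]. *)
Lemma exists_shifted_tail : exists2 P : probability T R,
  wasserstein_ball nrm xi theta P &
  (forall A, P A = \sum_p (mass p)%:E * \d_(moved p) A)%E.
Proof.
have [P PE] := exists_discrete_probability moved mass_ge0 mass_sum.
exists P => //.
pose pairs (p : idx) : T * T := (moved p, xi p.1 : T).
have [G GE] := exists_discrete_probability pairs mass_ge0 mass_sum.
apply: (@le_trans _ _ ('E_G[fun z => nrm ((z.1 : 'cV[R]_n) - z.2)%R])%E).
  apply: ereal_inf_lbound; exists G => // A mA; split.
    by rewrite [RHS]PE /pushforward [LHS]GE; apply: eq_bigr => p _;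
      rewrite !diracE.
  rewrite [RHS]empirical_discrete /pushforward [LHS]GE [LHS]sum_idx.
  apply: eq_bigr => i _.
  rewrite !diracE /= -ge0_muleDl ?lee_fin // -EFinD -mulrDr subrKC mulr1.
  by [].
rewrite expectation_integral.
apply: (le_trans (le_integral_discrete mass_ge0 (fun A _ => GE A) _)).
  by move=> z; rewrite lee_fin; exact: is_norm_ge0.
under eq_bigr do rewrite -EFinM.
rewrite sumEFin lee_fin sum_idx; apply: le_trans u_cost.
rewrite (eq_bigr (fun i => w i * (N%:R^-1 * nrm u))) => [|i _]; last first.
  rewrite /mass /pairs /moved /= [xi i + u]addrC addrK subrr is_norm0 //.
  rewrite mulr0 addr0.
  by rewrite mulrCA mulrA.
by rewrite -mulr_suml w_sum -mulrA mulVKf.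
Qed.

(** For every level [tau], dropping the excess of the unmoved parts and bounding
    that of the moved parts below by the difference itself makes [tau] cancel,
    because the moved mass is exactly [eps]. *)
Lemma cvar_shifted_tail_ge : exists2 P : probability T R,
  wasserstein_ball nrm xi theta P &
  ((N%:R^-1 * (\sum_(i < N) w i * loss (xi i + u)) / eps)%:E
     <= cvar P eps loss)%E.
Proof.
have [P Pball PE] := exists_shifted_tail; exists P => //.
apply: le_ereal_inf_tmp => _ [tau _ <-].
have -> : (N%:R^-1 * (\sum_(i < N) w i * loss (xi i + u)) / eps
          = tau + N%:R^-1 * (\sum_(i < N) w i * (loss (xi i + u) - tau)) / eps).
  under [in RHS]eq_bigr do rewrite mulrBr.
  rewrite sumrB.
  have -> : \sum_(i < N) w i * tau = eps * N%:R * tau.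
    by rewrite -mulr_suml w_sum.
  by field; rewrite N_neq0 gt_eqF.
rewrite EFinD EFinM; apply: leeD2l; apply: lee_wpmul2r.
  by rewrite lee_fin invr_ge0 ltW.
rewrite expectation_integral (integral_discrete mass_ge0 (fun A _ => PE A)).
- under [leRHS]eq_bigr do rewrite -EFinM.
  rewrite sumEFin lee_fin sum_idx mulr_sumr; apply: ler_sum => i _.
  apply: ler_wpDr.
    by apply: mulr_ge0; [exact: mass_ge0|exact: excess_ge0].
  rewrite mulrA; apply: ler_wpM2l => //; first by rewrite mulr_ge0 // invr_ge0.
  by rewrite /excess le_max lexx.
- by apply/measurable_EFinP; exact: mexcess.
- by move=> t; rewrite lee_fin; exact: excess_ge0.
Qed.

End shifted_tail.
End worst_case_cvar.

(** * The equivalence *)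

(** The empirical distribution ignores the order of the samples, so they may be
    taken in the order of their signed distances. *)
Lemma wasserstein_ball_perm {R : realType} {n N : nat} (nrm : 'cV[R]_n -> R)
    (xi : 'I_N -> 'cV[R]_n) (theta : R) (s : 'S_N) :
  wasserstein_ball nrm (fun i => xi (s i)) theta =
  wasserstein_ball nrm xi theta.
Proof.
rewrite /wasserstein_ball; apply/seteqP; rewrite /wasserstein.
suff E P : couplings P (empirical (fun i => xi (s i)))
         = couplings P (empirical xi).
  by split=> P /=; rewrite E.
have E A : empirical (fun i => xi (s i)) A = empirical xi A.
  by rewrite /empirical [in RHS](reindex_inj (@perm_inj _ s)).
by apply/seteqP; split=> G GP A mA; have [G1 G2] := GP A mA; split=> //;
  apply: eq_trans G2 _; rewrite [LHS]E || rewrite [RHS]E.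
Qed.

(** Here the samples are indexed by decreasing loss, so the weighted sum is the
    sum of the [eps * N] largest losses.  The upper bound uses [cvar_le] at the
    empirical value at risk, the lower bound shifts the tail as far along [v0] as
    the radius allows. *)
Theorem worst_case_cvarE {R : realType} {n N : nat} (nrm : 'cV[R]_n -> R)
    (xi : 'I_N -> 'cV[R]_n) (c v0 : 'cV[R]_n) (d eps theta : R) :
  is_norm nrm -> dot c v0 = 1 -> 0 < nrm v0 ->
  (forall u, nrm v0 * `|dot c u| <= nrm u) ->
  (0 < N)%N -> 0 < eps -> eps < 1 -> 0 <= theta ->
  (forall i j : 'I_N, (i <= j)%N -> d + dot c (xi j) <= d + dot c (xi i)) ->
  ereal_sup [set cvar P eps (fun u => d + dot c u)
            | P in wasserstein_ball nrm xi theta] =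
  ((N%:R^-1 * (\sum_(i < N) frac_weight (eps * N%:R) i * (d + dot c (xi i)))
    + theta / nrm v0) / eps)%:E.
Proof.
move=> nrmP cv0 v0_gt0 v0_min N_gt0 eps_gt0 eps_lt1 theta_ge0 sorted_xi.
set loss := fun u => d + dot c u.
set w := fun i : 'I_N => frac_weight (eps * N%:R) i.
have NR_gt0 : 0 < N%:R :> R by rewrite ltr0n.
have l_ge0 : 0 <= eps * N%:R by rewrite mulr_ge0 // ltW.
have l_lt : eps * N%:R < N%:R by rewrite gtr_pMl.
have loss_cont : continuous loss.
  move=> u; apply: continuousD; [exact: cst_continuous|exact: continuous_dot].
have loss_lip u v : nrm v0 * `|loss u - loss v| <= nrm (u - v).
  by rewrite /loss opprD addrACA subrr add0r -dotNr -dotDr.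
apply/eqP; rewrite eq_le; apply/andP; split.
  apply: ge_ereal_sup => _ [P Pball <-].
  have [tau tauE] := frac_weight_excess l_ge0 l_lt sorted_xi.
  apply: (le_trans (cvar_le eps_gt0 v0_gt0 loss_cont loss_lip tau Pball)).
  rewrite lee_fin (eq_bigr (fun i => w i * loss (xi i) - w i * tau)); last first.
    by move=> i _; rewrite -mulrBr -tauE.
  rewrite sumrB -[X in _ - X]mulr_suml (sum_frac_weight l_ge0 l_lt) le_eqVlt.
  by apply/orP; left; apply/eqP; field; rewrite !gt_eqF.
have [] := @cvar_shifted_tail_ge R n N nrm xi loss eps theta nrmP N_gt0 eps_gt0
  loss_cont w ((theta / (eps * nrm v0)) *: v0).
- by move=> i; exact: frac_weight_ge0.
- by move=> i; exact: frac_weight_le1.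
- exact: sum_frac_weight.
- rewrite (norm_homog nrmP) ger0_norm; last first.
    by apply: divr_ge0 => //; apply: mulr_ge0; exact: ltW.
  by rewrite le_eqVlt; apply/orP; left; apply/eqP; field; rewrite !gt_eqF.
move=> P Pball; set s := (X in (X%:E <= _)%E).
have -> : s = (N%:R^-1 * (\sum_(i < N) w i * loss (xi i)) + theta / nrm v0) / eps.
  rewrite /s /loss; under eq_bigr do rewrite dotDr dotZr cv0 mulr1 addrA mulrDr.
  rewrite big_split /= -mulr_suml (sum_frac_weight l_ge0 l_lt).
  by field; rewrite !gt_eqF.
move=> /le_trans; apply; apply: ereal_sup_ubound; by exists P.
Qed.

Theorem proposition7 (R : realType) (L K N : nat)
  (X : set 'cV[R]_L) (A : 'M[R]_(L, K)) (a : 'cV[R]_L) (b : 'cV[R]_K) (b0 : R)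
  (hat_xi : 'I_N -> 'cV[R]_K) (eps theta : R) (nrm : 'cV[R]_K -> R)
  (X_polyhedron : polyhedron X) (X_compact : compact X)
  (Ax_neq_b : forall x : 'cV[R]_L, X x -> A^T *m x <> b)
  (N_gt0 : (0 < N)%N) (eps_gt0 : 0 < eps) (eps_lt1 : eps < 1)
  (theta_ge0 : 0 <= theta) (nrm_norm : is_norm nrm)
  (x : 'cV[R]_L) (Xx : X x) (pi : 'S_N)
  (pi_sorts : forall i j : 'I_N, (i <= j)%N ->
     sgn_dist nrm (hat_xi (pi i)) (unsafe_set A a b b0 x) <=
     sgn_dist nrm (hat_xi (pi j)) (unsafe_set A a b b0 x)) :
  (ereal_sup [set cvar P eps
                    (fun xi => (dot a x - b0 + dot (A^T *m x - b) xi)%R)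
             | P in wasserstein_ball nrm hat_xi theta] <= 0)%E
  <->
  N%:R^-1 * frac_sum (eps * N%:R)
    [seq sgn_dist nrm (hat_xi (pi i)) (unsafe_set A a b b0 x)
    | i <- enum 'I_N] >= theta.
Proof.
have NR_gt0 : 0 < N%:R :> R by rewrite ltr0n.
have c_neq0 : A^T *m x - b <> 0 by move=> /subr0_eq; exact: Ax_neq_b.
have [v0 [cv0 v0_gt0 v0_min]] := exists_support_point nrm_norm c_neq0.
have sgnE u : sgn_dist nrm u (unsafe_set A a b b0 x)
    = - (nrm v0 * (dot a x - b0 + dot (A^T *m x - b) u)).
  by rewrite unsafe_halfspace; exact: sgn_dist_halfspace.
rewrite frac_sum_weight; [|by rewrite mulr_ge0 ?ltW|by rewrite gtr_pMl].
rewrite (eq_bigr (fun i : 'I_N => - nrm v0 * (frac_weight (eps * N%:R) i *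
    (dot a x - b0 + dot (A^T *m x - b) (hat_xi (pi i)))))) => [|i _]; last first.
  by rewrite sgnE mulNr mulrN mulrCA.
rewrite -(wasserstein_ball_perm _ _ _ pi).
rewrite (worst_case_cvarE nrm_norm cv0 v0_gt0 v0_min) //; last first.
  by move=> i j /pi_sorts; rewrite !sgnE lerN2 ler_pM2l.
rewrite -mulr_sumr lee_fin; set S := \sum_(i < N) _.
rewrite pmulr_lle0 ?invr_gt0 // -lerBrDl sub0r ler_pdivrMr //.
by rewrite mulrCA mulNr mulrC mulNr.
Qed.
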